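(* Let $h:[0,\infty)\to(0,\infty)$ be an increasing function satisfying $$\sum_{j=1}^\infty \frac{1}{j\,h(j)}<\infty,$$ and suppose there exists $\gamma>0$ such that $h(\delta x)\geq \gamma\, \delta\, h(x)$ for all $\delta\in [0,1]$ and all $x\ge 0$. Then there is a positive function $\psi$ with $\lim_{x\to\infty}\psi(x)=\infty$ and $$\sum_{k=1}^\infty \psi(k)^{-2}<\infty$$ such that the wedge $\mathcal{W}_h$ satisfies $\mathcal{IP}^*_\psi$.
   Context: The wedge $\mathcal{W}_h$ is the subgraph of the nearest-neighbour lattice $\mathbb{Z}^3$ induced by the vertices $V(\mathcal{W}_h)=\{(x,y,z)\in\mathbb{Z}^3 : x \geq 0 \text{ and } |z| \leq h(x)\}$. For a connected bounded degree infinite graph $G$ with a fixed vertex $o$ and a positive function $\psi$ with $\lim_{x\to\infty}\psi(x)=\infty$, $G$ satisfies the anchored $\psi$-isoperimetric inequality, denoted $\mathcal{IP}^*_\psi$, if $$0<\iota^*_\psi(G):=\lim_{n\to\infty}\inf\Bigl\{\frac{|\partial S|}{\psi(|S|)} : o\in S\subset V(G),\ S\text{ connected},\ n\le|S|<\infty\Bigr\},$$ where $\partial S$ is the edge boundary (edges of $G$ with exactly one endpoint in $S$); because of bounded degrees a vertex boundary can equally be used, and the property does not depend on the choice of $o$. *)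

(* Defs.v *)
(* MathComp-Analysis: [R : realType] plays the role of the real line. *)
From mathcomp Require Import all_boot all_order all_algebra.
From mathcomp Require Import finmap zify.
From mathcomp Require Import all_classical all_reals all_analysis.
Import Order.TTheory GRing.Theory Num.Theory.
Import numFieldNormedType.Exports.

Set Implicit Arguments.
Unset Strict Implicit.
Unset Printing Implicit Defensive.

Local Open Scope fset_scope.
Local Open Scope classical_set_scope.
Local Open Scope ring_scope.

Section AnchoredIsoperimetry.
Context {V : choiceType}.
Implicit Types (e : rel V) (S : {fset V}) (o : V).

Definition induced_connected e S : Prop :=
  forall u v : S, connect (relpre val e) u v.

(* For a symmetric [e], an edge with exactly one endpoint in [S] is represented
   by the unique orientation (u, v) of it that leaves [S]. *)
Definition edge_boundary e S : set (V * V) :=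
  [set uv | [&& uv.1 \in S, uv.2 \notin S & e uv.1 uv.2]].

(* [fset_set] sends an infinite set to [fset0], so this is the cardinality of
   the boundary only if the graph is locally finite; see
   [wedge_finite_edge_boundary] for the wedges. *)
Definition edge_boundary_size e S : nat := #|` fset_set (edge_boundary e S) |.

Definition anchored_sets e o (n : nat) : set {fset V} :=
  [set S | [/\ o \in S, induced_connected e S & (n <= #|` S |)%N]].

Definition anchored_profile (R : realType) e o (psi : R -> R) (n : nat)
    : \bar R :=
  ereal_inf [set ((edge_boundary_size e S)%:R / psi (#|` S |)%:R)%:E
            | S in anchored_sets e o n].

Definition anchored_constant (R : realType) e o (psi : R -> R) : \bar R :=
  limn (anchored_profile e o psi).

Definition anchored_IP (R : realType) e o (psi : R -> R) : Prop :=
  (0 < anchored_constant e o psi)%E.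

(* The limit in [anchored_constant] always exists in the extended reals. *)
Lemma anchored_profile_is_cvg (R : realType) e o (psi : R -> R) :
  cvgn (anchored_profile e o psi).
Proof.
apply: ereal_nondecreasing_is_cvgn => m n mn.
apply: ereal_inf_le_tmp => _ [S [oS cS nS] <-]; exists S => //.
by split=> //; apply: leq_trans mn nS.
Qed.

End AnchoredIsoperimetry.

Definition lattice : choiceType := (int * int * int)%type.

Definition lattice_adj : rel lattice := fun u v =>
  `|u.1.1 - v.1.1| + `|u.1.2 - v.1.2| + `|u.2 - v.2| == 1.

Section Wedge.
Context {R : realType}.
Implicit Type h : R -> R.

Definition in_wedge h : pred lattice := fun v =>
  (0 <= v.1.1) && (`|v.2|%:~R <= h v.1.1%:~R).

Definition wedge h : choiceType := {v : lattice | in_wedge h v}.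

Definition wedge_adj h : rel (wedge h) := relpre val lattice_adj.

Lemma wedge_adj_sym h : symmetric (@wedge_adj h).
Proof.
move=> u v; rewrite /wedge_adj /lattice_adj /=.
by rewrite (distrC (val u).1.1) (distrC (val u).1.2) (distrC (val u).2).
Qed.

Lemma wedge_finite_edge_boundary h (S : {fset wedge h}) :
  finite_set (edge_boundary (@wedge_adj h) S).
Proof.
pose D : set int := [set` [:: -1; 0; 1]].
pose w : wedge h -> lattice := val.
pose A : set lattice := w @` [set` S].
pose g (p : lattice * int * int * int) : lattice * lattice :=
  let u := p.1.1.1 in (u, (u.1.1 + p.1.1.2, u.1.2 + p.1.2, u.2 + p.2)).
pose f (p : wedge h * wedge h) : lattice * lattice := (val p.1, val p.2).
have finD : finite_set D by exact: finite_seq.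
have finA : finite_set A by apply: finite_image; exact: finite_fset.
have finB : finite_set (g @` (A `*` D `*` D `*` D)).
  by apply: finite_image; do 3 apply: finite_setX => //.
have f_inj : injective f.
  by move=> [a b] [c d] [] /= /val_inj -> /val_inj ->.
apply: sub_finite_set (finite_preimage (in2W f_inj) finB).
move=> [u v] /and3P[/= uS _]; rewrite /wedge_adj /lattice_adj /= => /eqP uv.
have small (a b : int) : `|a - b| <= 1 -> D (b - a).
  rewrite /D /= !inE => ab.
  have : (b - a == -1) \/ (b - a == 0) \/ (b - a == 1) by lia.
  by case=> [->|[->|->]]; rewrite ?orbT.
exists (val u, (val v).1.1 - (val u).1.1, (val v).1.2 - (val u).1.2,
        (val v).2 - (val u).2) => /=.
  split; [split; [split|]|] => /=.
  - by exists u.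
  - by apply: small; lia.
  - by apply: small; lia.
  - by apply: small; lia.
rewrite /g /f /=; congr (_, _).
by case: (val v) => [[a b] c] /=; rewrite ![_ + (_ - _)]addrC !subrK.
Qed.

End Wedge.

(* Main.v *)
(* Write B for the size of the boundary of a finite set S of volume t.  Moving
   up in the x- or y-direction never leaves the wedge, so the projections of S
   along x and y have at most B points, and so does the set of columns
   (x, y) x {|z| <= h x} that S meets but does not fill.  The part V of S in the
   unfilled columns satisfies V^2 <= B^3 by Loomis-Whitney.  If the filled
   columns occupy N values of x, their volume is at most N * B, and since at
   least N/2 of these values are >= N/2 the projection along y gives
   (N/2) h(N/2) <= B.
   Let rho t be the least r with t < r^2 h(r), and psi t = (t + 1) / rho t.
   Comparing N with rho t, and using that h grows at most linearly for the
   unfilled part, one gets t <= K * rho t * B for large t, whether or not S is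
   connected.  Writing rho^2 as a sum of odd numbers and exchanging the sums,
   sum_k psi(k)^-2 <= 1 + sum_m (2m + 1) sum_(k >= m^2 h(m)) 1/(k+1)^2
   <= 1 + 3 sum_m 1/(m h(m)). *)
Require Import Defs.
From mathcomp Require Import all_boot all_order all_algebra.
From mathcomp Require Import finmap zify lra.
From mathcomp Require Import all_classical all_reals all_analysis.
Import Order.TTheory GRing.Theory Num.Theory.
Import numFieldNormedType.Exports.

Set Implicit Arguments.
Unset Strict Implicit.
Unset Printing Implicit Defensive.

Local Open Scope fset_scope.
Local Open Scope classical_set_scope.
Local Open Scope ring_scope.

(** * Cauchy-Schwarz for finite sums and the Loomis-Whitney inequality *)

Lemma sqr_sum_leq (I : Type) (r : seq I) (f : I -> nat) :
  ((\sum_(i <- r) f i) ^ 2 <= size r * \sum_(i <- r) f i ^ 2)%N.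
Proof.
have sumC c : (\sum_(i <- r) c = size r * c)%N.
  by rewrite big_const_seq count_predT iter_addn_0 mulnC.
rewrite -(@leq_pmul2l 2) // [(_ ^ 2)%N]expnS expn1 big_distrlr /= big_distrr /=.
apply: (@leq_trans (\sum_(i <- r) \sum_(j <- r) (f i ^ 2 + f j ^ 2))%N).
  apply: leq_sum => i _; rewrite big_distrr /=; apply: leq_sum => j _.
  exact: nat_Cauchy.
under eq_bigr do rewrite big_split /= sumC.
by rewrite big_split /= sumC -big_distrr /= addnn -mul2n.
Qed.

(** By Cauchy-Schwarz over the columns of [T], it suffices to count the ordered pairs [(v, w)] of
    points in a common column. Such a pair is recovered from [(y, z)] of [v] and [(x, z)] of [w],
    since [v] and [w] share [x] and [y]. *)
Lemma loomis_whitney (X Y Z : choiceType) (T : {fset X * Y * Z}) :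
  (#|` T| ^ 2 <= #|` [fset v.1 | v in T]| *
     (#|` [fset (v.1.2, v.2) | v in T]| * #|` [fset (v.1.1, v.2) | v in T]|))%N.
Proof.
pose s p := (\sum_(v <- T | v.1 == p) 1)%N.
rewrite card_fset_sum1 (partition_big_imfset _ (fun v : X * Y * Z => v.1)) /=.
apply: leq_trans (sqr_sum_leq _ _) _; rewrite leq_mul2l; apply/orP; right.
pose Q := [seq (v, w) | v <- T, w <- [seq w <- T | w.1 == v.1]].
have -> : (\sum_(p <- [fset v.1 | v in T]) s p ^ 2 = size Q)%N.
  rewrite size_allpairs_dep sumnE big_map.
  rewrite (partition_big_imfset _ (fun v : X * Y * Z => v.1)) /=.
  apply: eq_bigr => p _; rewrite expnS expn1 {2}/s big_distrr /=.
  by apply: eq_bigr => v /eqP vp; rewrite muln1 size_filter -sum1_count vp.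
have uQ : uniq Q.
  apply: allpairs_uniq_dep => [|v _|[v w] [v' w'] _ _ /= [-> ->]] //.
    exact: fset_uniq.
  by apply: filter_uniq; exact: fset_uniq.
have memQ v w : ((v, w) \in Q) = [&& v \in T, w \in T & w.1 == v.1].
  apply/allpairsPdep/idP => [[v' [w' [v'T]]]|/and3P[vT wT vw]].
    by rewrite mem_filter => /andP[vw' w'T] [-> ->]; apply/and3P.
  by exists v, w; split; rewrite ?mem_filter ?vw.
pose g (q : (X * Y * Z) * (X * Y * Z)) := ((q.1.1.2, q.1.2), (q.2.1.1, q.2.2)).
have g_inj : {in Q &, injective g}.
  move=> [[[x y] z] [[x' y'] z']] [[[a b] c] [[a' b'] c']].
  rewrite !memQ /g /= => /and3P[_ _ /eqP[-> ->]] /and3P[_ _ /eqP[-> ->]].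
  by move=> [-> -> -> ->].
rewrite -(size_map g) -(size_allpairs pair); apply: uniq_leq_size.
  by rewrite map_inj_in_uniq.
move=> _ /mapP[[v w] + ->]; rewrite memQ => /and3P[vT wT _].
by apply: allpairs_f; [apply/imfsetP; exists v | apply/imfsetP; exists w].
Qed.

(** * The scale [rho] and the convergence of the series *)

Lemma sum_inv_sqr_le (R : realFieldType) (K : R) (n : nat) : 0 < K ->
  \sum_(1 <= k < n.+1 | K <= k%:R) (k.+1%:R ^- 2) <= K^-1.
Proof.
move=> K0.
(* The subtracted term makes the induction telescope: [1/(k+1)^2 <= 1/k - 1/(k+1)]. The sum stays
   empty while [n < K]. *)
suff : \sum_(1 <= k < n.+1 | K <= k%:R) (k.+1%:R ^- 2)
    <= if K <= n.+1%:R then K^-1 - n.+1%:R^-1 else 0.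
  move=> /le_trans; apply; case: ifP => _; last by rewrite invr_ge0 ltW.
  by rewrite gerBl invr_ge0 ler0n.
elim: n => [|n IH].
  rewrite big_geq //; case: ifP => // K1.
  by rewrite subr_ge0 lef_pV2 // posrE ltr0n.
rewrite big_mkcond big_nat_recr //= -big_mkcond /=.
have [Kn|nK] := leP K n.+1%:R; rewrite ?Kn /= in IH *.
  have -> : K <= n.+2%:R by apply: le_trans Kn _; rewrite ler_nat.
  apply: le_trans (lerD IH (lexx _)) _; rewrite -!addrA lerD2l -exprVn.
  have : n.+1%:R * n.+1%:R^-1 = 1 :> R by rewrite divff.
  have : n.+2%:R * n.+2%:R^-1 = 1 :> R by rewrite divff.
  have : 0 < n.+1%:R^-1 :> R by rewrite invr_gt0 ltr0n.
  move: n.+2%:R^-1 n.+1%:R^-1 => y x; rewrite -[n.+2%:R]natr1.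
  move: n.+1%:R => a x0 ay ax.
  have xy : x - y = x * y.
    have -> : x - y = x * ((a + 1) * y) - y * (a * x) by rewrite ay ax !mulr1.
    by lra.
  have : 0 <= x * y ^+ 2 by rewrite mulr_ge0 ?sqr_ge0 ?ltW.
  by nra.
rewrite [K <= _]leNgt nK addr0 /= in IH *; apply: le_trans IH _.
case: ifP => // Kn.
by rewrite subr_ge0 lef_pV2 // posrE ltr0n.
Qed.

Lemma scale_ex (R : realType) (h : R -> R)
    (h_pos : forall x : R, 0 <= x -> 0 < h x)
    (h_incr : forall x y : R, 0 <= x -> x <= y -> h x <= h y) :
  {rho : R -> nat | forall t, t < (rho t)%:R ^+ 2 * h (rho t)%:R
     /\ forall m, (m < rho t)%N -> m%:R ^+ 2 * h m%:R <= t}.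
Proof.
suff /choice[rho rhoP] : forall t : R, exists r : nat, t < r%:R ^+ 2 * h r%:R
     /\ forall m, (m < r)%N -> m%:R ^+ 2 * h m%:R <= t by exists rho.
move=> t; have h0 := h_pos 0 (lexx _).
have ex : exists r : nat, t < r%:R ^+ 2 * h r%:R.
  (* It is enough that [t < r * h 0], because [r <= r^2] for [r >= 1] and [h 0 <= h r]. *)
  pose r := (Num.bound `|t / h 0|).+1; exists r.
  have r1 : 1 <= r%:R :> R by rewrite ler1n.
  have tr : t / h 0 < r%:R.
    apply: le_lt_trans (ler_norm _) (lt_le_trans (archi_boundP _) _) => //.
    by rewrite ler_nat.
  rewrite ltr_pdivrMr // in tr; apply: lt_le_trans tr _.
  apply: ler_pM; rewrite ?ler0n ?(ltW h0) //.
    by rewrite expr2 ler_peMr // ler0n.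
  by apply: h_incr => //; rewrite ler0n.
case: (ex_minnP ex) => r tr rmin; exists r; split=> // m.
by apply: contraTT; rewrite -ltNge -leqNgt; exact: rmin.
Qed.

Lemma scale_series_lty (R : realType) (h : R -> R) (rho : R -> nat)
    (h_pos : forall x : R, 0 <= x -> 0 < h x)
    (h_sum : (\sum_(1 <= j <oo) ((j%:R * h j%:R)^-1)%:E < +oo)%E)
    (rho_le : forall t m, (m < rho t)%N -> m%:R ^+ 2 * h m%:R <= t) :
  (\sum_(1 <= k <oo) (((k.+1%:R / (rho k%:R)%:R) ^- 2 : R)%:E) < +oo)%E.
Proof.
have u0 j : 0 <= (j%:R * h j%:R)^-1.
  by rewrite invr_ge0 mulr_ge0 // ltW // h_pos.
set U := (\sum_(1 <= j <oo) _)%E in h_sum.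
have U_fin : U \is a fin_num.
  rewrite ge0_fin_numE //; apply: nneseries_ge0 => j _ _; by rewrite lee_fin.
suff bound n : (\sum_(1 <= k < n) ((k.+1%:R / (rho k%:R)%:R) ^- 2 : R)%:E
    <= (1 + 3 * fine U)%:E)%E.
  apply: (@le_lt_trans _ _ (1 + 3 * fine U)%:E); last exact: ltry.
  apply: lime_le; last by apply: nearW => n; exact: bound.
  by apply: is_cvg_nneseries => k _ _; rewrite lee_fin invr_ge0 sqr_ge0.
have partialU M : \sum_(1 <= j < M) (j%:R * h j%:R)^-1 <= fine U.
  rewrite -lee_fin fineK // -sumEFin.
  by apply: nneseries_lim_ge => j _ _; rewrite lee_fin.
rewrite sumEFin lee_fin.
have U_ge0 : 0 <= fine U by rewrite (le_trans _ (partialU 0%N)) // big_geq.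
case: n => [|n]; first by rewrite big_geq // addr_ge0 // mulr_ge0.
(* A common bound on the values of [rho]: with it the range of [m] no longer depends on [k] and the
   two sums can be exchanged. *)
pose M := \max_(k < n.+1) rho k%:R.
have sum_odd r : \sum_(0 <= m < r) m.*2.+1%:R = r%:R ^+ 2 :> R.
  elim: r => [|r IH]; first by rewrite big_geq // expr0n.
  by rewrite big_nat_recr //= IH -!natrX -natrD; congr _%:R; lia.
have rhoE k : (k < n.+1)%N -> (k.+1%:R / (rho k%:R)%:R) ^- 2
    = \sum_(0 <= m < M.+1 | (m < rho k%:R)%N) (m.*2.+1%:R * k.+1%:R ^- 2) :> R.
  move=> kn; rewrite -big_distrl /= exprMn invfM exprVn invrK mulrC.
  congr (_ * _); rewrite -sum_odd (big_nat_widen 0 (rho k%:R) M.+1) //.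
  by apply: leqW; exact: (leq_bigmax (Ordinal kn)).
rewrite big_nat.
under eq_bigr => k /andP[_ kn] do rewrite rhoE //.
rewrite -big_nat (exchange_big_dep_nat predT) //=.
rewrite big_nat_recl //=.
(* After the exchange, [m < rho k] restricts [k] to [k >= K], which leaves a tail of the inverse
   squares. *)
have tail m K : 0 < K ->
    (forall k, (0 < k)%N -> (m < rho k%:R)%N -> K <= k%:R) ->
    \sum_(1 <= k < n.+1 | (m < rho k%:R)%N) (m.*2.+1%:R * k.+1%:R ^- 2)
      <= m.*2.+1%:R / K :> R.
  move=> K0 Kle; rewrite -big_distrr /= ler_wpM2l //.
  apply: le_trans (sum_inv_sqr_le n K0).
  rewrite big_mkcond [leRHS]big_mkcond /=.
  apply: ler_sum_nat => k /andP[k0 _]; case: ifP => [mk|_].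
    by rewrite Kle.
  by case: ifP => // _; rewrite invr_ge0 sqr_ge0.
apply: lerD.
  (* For [m = 0] the bound [m^2 h m] is zero, so [k >= 1] is used instead; this is the summand 1. *)
  rewrite -[leRHS]divr1; apply: tail => // k k0 _; by rewrite ler1n.
apply: le_trans (ler_wpM2l _ (partialU M.+1)) => //.
rewrite big_add1 /= big_distrr /=.
apply: ler_sum_nat => m _.
have m0' : 0 < m.+1%:R :> R by rewrite ltr0n.
have hm : 0 < h m.+1%:R by apply: h_pos; exact: ltW.
apply: le_trans (tail m.+1 (m.+1%:R ^+ 2 * h m.+1%:R) _ _) _.
- by rewrite mulr_gt0 ?exprn_gt0.
- by move=> k _; exact: rho_le.
(* The factor 3 comes from [2m + 1 <= 3m] for [m >= 1], here at [m.+1]. *)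
rewrite expr2 -mulrA invfM mulrA ler_wpM2r ?invr_ge0 ?mulr_ge0 ?(ltW hm) //.
rewrite ler_pdivrMr // -natrM ler_nat; lia.
Qed.

(** * Finding boundary edges along lines of the lattice *)

Lemma iter_escape (T : choiceType) (S : {fset T}) (f : T -> T) (c : T -> int)
    (u : T) : (forall v, c (f v) = c v + 1) -> u \in S ->
  exists n, iter n f u \in S /\ f (iter n f u) \notin S.
Proof.
move=> cf uS; apply: contrapT => stay.
have in_S n : iter n f u \in S.
  elim: n => // n IH; rewrite iterS; apply: contrapT => /negP out.
  by apply: stay; exists n.
have c_iter n : c (iter n f u) = c u + n%:Z.
  by elim: n => [|n IH]; rewrite ?addr0 // iterS cf IH; lia.
(* Pigeonhole: [c] separates the iterates, so an orbit that stays in [S] would give [#|S| + 1]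
   distinct points of [S]. *)
have : (size [seq iter n f u | n <- iota 0 #|` S|.+1] <= #|` S|)%N.
  apply: uniq_leq_size => [|_ /mapP[n _ ->] //].
  rewrite map_inj_uniq ?iota_uniq // => m n /(congr1 c); rewrite !c_iter; lia.
by rewrite size_map size_iota ltnn.
Qed.

Section WedgeIsoperimetry.
Context {R : realType} (h : R -> R).
Implicit Types (S : {fset wedge h}) (u v w : wedge h).

Local Notation adj := (@wedge_adj R h).
Local Notation bnd S := (edge_boundary_size adj S).

(* Presents a vertex at the concrete product type, so that projections and
   [lattice]-valued lemmas unify. *)
Definition wedge_pt (v : wedge h) : int * int * int := val v.

Lemma wedge_pt_inj : injective wedge_pt.
Proof. exact: val_inj. Qed.

Lemma wedge_ptP (p : int * int * int) : in_wedge h p ->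
  exists v, wedge_pt v = p.
Proof. by move=> hp; exists (exist _ p hp). Qed.

Definition wedge_shape S : {fset int * int * int} := [fset wedge_pt v | v in S].

Lemma mem_wedge_shape S v : (wedge_pt v \in wedge_shape S) = (v \in S).
Proof. exact/mem_imfset/wedge_pt_inj. Qed.

(** Labelling each boundary edge by [q] of its inner endpoint covers [A], and an image is no larger
    than its source. *)
Lemma leq_edge_boundary S (K : choiceType) (q : int * int * int -> K)
    (A : {fset K}) :
  (forall p, p \in A -> exists u v,
     [/\ u \in S, v \notin S, adj u v & q (wedge_pt u) = p]) ->
  (#|` A| <= bnd S)%N.
Proof.
move=> Abnd; pose E := fset_set (edge_boundary adj S).
apply: (@leq_trans #|` [fset q (wedge_pt e.1) | e in E]|%fset);
  last exact: leq_imfset_card.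
apply/fsubset_leq_card/fsubsetP => p /Abnd[u [v [uS vS uv <-]]].
apply/imfsetP; exists (u, v) => //=.
rewrite in_fset_set ?inE /=; first exact/and3P.
exact: wedge_finite_edge_boundary.
Qed.

(** Translating a point of [S] by [s] until it leaves [S] yields a boundary edge with the same
    label, as [s] preserves [q]; the coordinate [c] forces the exit. *)
Lemma leq_edge_boundary_step S (K : choiceType) (q : int * int * int -> K)
    (c : int * int * int -> int) (s : int * int * int -> int * int * int) :
  (forall p, in_wedge h p -> in_wedge h (s p)) ->
  (forall p, lattice_adj p (s p)) ->
  (forall p, q (s p) = q p) -> (forall p, c (s p) = c p + 1) ->
  (#|` [fset q p | p in wedge_shape S]| <= bnd S)%N.
Proof.
move=> s_wedge s_adj qs cs; apply: (leq_edge_boundary (q := q)).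
move=> _ /imfsetP[_ /= /imfsetP[u /= uS ->] ->].
pose f (v : wedge h) : wedge h := exist _ (s (wedge_pt v)) (s_wedge _ (valP v)).
have [n [inS outS]] := iter_escape (c := c \o wedge_pt) (f := f)
  (fun v => cs (wedge_pt v)) uS.
exists (iter n f u), (f (iter n f u)); split=> //.
  exact: s_adj.
by elim: n {inS outS} => // n IH; rewrite iterS -IH; exact: qs.
Qed.

(** Holds by default over base points outside the wedge, so it is only used together with a point of
    [S] in the column. *)
Definition full_column S (p : int * int) : bool :=
  `[< forall z, in_wedge h (p, z) -> (p, z) \in wedge_shape S >].

(* Move u one step towards v: either this leaves S, or u gets closer to v. *)
Lemma column_crossing S u v : u \in S -> v \notin S ->
  (wedge_pt u).1 = (wedge_pt v).1 -> exists u' v',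
  [/\ u' \in S, v' \notin S, adj u' v' & (wedge_pt u').1 = (wedge_pt u).1].
Proof.
have [n] := ubnP `|(wedge_pt u).2 - (wedge_pt v).2|%N.
elim: n u => // n IH u uv_n uS vS uv.
set a := (wedge_pt u).2 in uv_n; set b := (wedge_pt v).2 in uv_n.
have ab : a <> b.
  move=> ab; have /wedge_pt_inj uv' : wedge_pt u = wedge_pt v.
    by rewrite [LHS]surjective_pairing [RHS]surjective_pairing uv -/a ab.
  by move: vS; rewrite -uv' uS.
pose z := if a < b then a + 1 else a - 1.
have [w wE] : exists w, wedge_pt w = ((wedge_pt u).1, z).
  apply: wedge_ptP.
  have /andP[u0 ua] : in_wedge h (wedge_pt u) by exact: valP u.
  have /andP[_ vb] : in_wedge h (wedge_pt v) by exact: valP v.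
  rewrite -uv -/b in vb; rewrite -/a in ua; apply/andP; split=> //=.
  (* The column is an interval of heights symmetric about 0, and [z] lies between [a] and [b], so
     the step stays in the wedge. *)
  have [zab|zab] : `|z| <= `|a| \/ `|z| <= `|b|.
  - by rewrite /z; case: (ltP a b) => ?; lia.
  - by apply: le_trans ua; rewrite ler_int.
  - by apply: le_trans vb; rewrite ler_int.
have uw : adj u w.
  change (lattice_adj (wedge_pt u) (wedge_pt w)); rewrite wE /lattice_adj /=.
  by rewrite -/a /z; case: (ltP a b) => ?; lia.
have [wS|wS] := boolP (w \in S); last by exists u, w.
have [||u' [v' [? ? ? wu]]] := IH w _ wS vS.
- by rewrite wE /= -/b /z; case: (ltP a b) => ?; lia.
- by rewrite wE.
by exists u', v'; split=> //; rewrite wu wE.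
Qed.

(** A partly filled column contains a point of [S] and a wedge point outside [S]; the vertical path
    between them crosses the boundary. *)
Lemma leq_partial_columns S :
  (#|` [fset p.1 | p in wedge_shape S & ~~ full_column S p.1]| <= bnd S)%N.
Proof.
apply: (leq_edge_boundary (q := fun p => p.1)).
move=> _ /imfsetP[_ /= /andP[/imfsetP[u /= uS ->] +] ->].
move=> /asboolPn/existsNP[z /not_implyP[/wedge_ptP[v vE] /negP]].
rewrite -vE mem_wedge_shape => vS.
have [|u' [v' ?]] := column_crossing uS vS; first by rewrite vE.
by exists u', v'.
Qed.

Lemma mem_wedge_shapeP S p : p \in wedge_shape S -> in_wedge h p.
Proof. by case/imfsetP => v _ ->; exact: (valP v). Qed.

(** * Projections and filled columns when [h] is positive and increasing *)

Context (h_pos : forall x : R, 0 <= x -> 0 < h x).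
Context (h_incr : forall x y : R, 0 <= x -> x <= y -> h x <= h y).

Lemma leq_proj_x S :
  (#|` [fset (p.1.2, p.2) | p in wedge_shape S]| <= bnd S)%N.
Proof.
apply: (@leq_edge_boundary_step S (int * int)%type
  (fun p => (p.1.2, p.2)) (fun p => p.1.1)
  (fun p => (p.1.1 + 1, p.1.2, p.2))) => // [p|p].
  move=> /andP[p0 ph]; apply/andP; split; first by rewrite /= addr_ge0.
  by apply: le_trans ph _; apply: h_incr; rewrite ?ler0z // ler_int /= lerDl.
by rewrite /lattice_adj /=; lia.
Qed.

Lemma leq_proj_y S :
  (#|` [fset (p.1.1, p.2) | p in wedge_shape S]| <= bnd S)%N.
Proof.
apply: (@leq_edge_boundary_step S (int * int)%type
  (fun p => (p.1.1, p.2)) (fun p => p.1.2)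
  (fun p => (p.1.1, p.1.2 + 1, p.2))) => // p.
by rewrite /lattice_adj /=; lia.
Qed.

Definition full_part S := [fset p in wedge_shape S | full_column S p.1]%fset.
Definition full_base S := [fset p.1.1 | p in full_part S]%fset.

(** A point is determined by its [x] and its projection along x. *)
Lemma leq_full_part S : (#|` full_part S| <= #|` full_base S| * bnd S)%N.
Proof.
apply: leq_trans (leq_mul (leqnn _) (leq_proj_x S)).
pose g (p : int * int * int) := (p.1.1, (p.1.2, p.2)).
have g_inj : injective g by move=> [[x y] z] [[x' y'] z'] [-> -> ->].
rewrite -(size_map g) -(size_allpairs pair); apply: uniq_leq_size.
  by rewrite map_inj_uniq ?fset_uniq.
move=> _ /mapP[p pT ->]; apply: allpairs_f; apply/imfsetP; exists p => //=.
by move: pT; rewrite !inE => /andP[].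
Qed.

(** At most [k] of the values of [x] lie below [k], so at least [k] lie above. Over each of those
    some filled column contains all heights [z] with [0 <= z <= h k], and these points stay distinct
    in the projection along y. *)
Lemma full_base_le S (k := #|` full_base S|./2) :
  k%:R * h k%:R <= (bnd S)%:R.
Proof.
set X := full_base S in k *.
pose nats n := [seq i%:Z | i <- iota 0 n].
have nats_uniq n : uniq (nats n).
  by rewrite map_inj_uniq ?iota_uniq // => ? ? [].
have mem_nats n (z : int) : (z \in nats n) = (0 <= z < n%:Z).
  apply/mapP/idP => [[i + ->]|zn]; first by rewrite mem_iota; lia.
  by exists `|z|%N; rewrite ?mem_iota; lia.
have full x : x \in X ->
    exists2 p : int * int * int, full_column S p.1 & p.1.1 = x /\ 0 <= x.
  move=> /imfsetP[p /=]; rewrite !inE => /andP[pS pf] ->; exists p => //.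
  by have /andP[] := mem_wedge_shapeP pS.
pose X' := [seq x <- X | k%:Z <= x].
have X'k : (k <= size X')%N.
  suff : (size X <= size (X' ++ nats k))%N.
    by rewrite size_cat size_map size_iota /k; lia.
  apply: uniq_leq_size (fset_uniq _) _ => x xX.
  rewrite mem_cat mem_filter xX mem_nats andbT.
  by have [p _ [_ ->]] := full x xX; case: leP.
(* The number of integers [z] with [0 <= z <= h k]; it exceeds [h k]. *)
pose m := (Num.trunc (h k%:R)).+1.
have hm : h k%:R <= m%:R by apply/ltW/truncnS_gt.
apply: (@le_trans _ _ (size X' * m)%N%:R).
  by rewrite natrM ler_pM // ?ler_nat // ltW // h_pos.
rewrite ler_nat; apply: leq_trans (leq_proj_y S).
rewrite -[m in (_ * m)%N](size_iota 0 m) -(size_map Posz) -(size_allpairs pair).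
apply: uniq_leq_size.
  apply: allpairs_uniq => [||[? ?] [? ?] _ _ [-> ->] //].
    exact/filter_uniq/fset_uniq.
  exact: (nats_uniq m).
move=> _ /allpairsP[[x z] /= [+ zm ->]]; rewrite mem_filter => /andP[kx xX].
have [p /asboolP pf [px x0]] := full x xX.
apply/imfsetP; exists (p.1, z) => /=; last by rewrite px.
apply: pf; rewrite /in_wedge /= px x0 /=.
have /andP[z0 {}zm] : 0 <= z < m%:Z by rewrite -mem_nats.
rewrite ger0_norm //; apply: (@le_trans _ _ (h k%:R)).
  apply: le_trans (_ : (Num.trunc (h k%:R))%:R <= _);
    last by rewrite truncn_le ltW // h_pos.
  by rewrite -[leRHS]/((Num.trunc (h k%:R))%:Z%:~R) ler_int; lia.
by apply: h_incr => //; rewrite -[k%:R]/(k%:Z%:~R) ler_int.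
Qed.

Lemma wedge_isoperimetry S : exists N V : nat,
  [/\ (#|` S| <= N * bnd S + V)%N, (V ^ 2 <= bnd S ^ 3)%N
    & N./2%:R * h N./2%:R <= (bnd S)%:R].
Proof.
pose T := wedge_shape S.
pose P := [fset p in T | ~~ full_column S p.1]%fset.
(* [P] is the part of [S] in unfilled columns; Loomis-Whitney applies to it, each of its three
   projections having at most [bnd S] points. *)
exists #|` full_base S|, #|` P|; split; last exact: full_base_le.
  have -> : #|` S| = #|` T| by rewrite card_imfset //; exact: wedge_pt_inj.
  rewrite -(cardfsID (full_part S) T).
  apply: leq_add.
    apply: leq_trans (leq_full_part S).
    by apply/fsubset_leq_card/fsubsetIr.
  apply/fsubset_leq_card/fsubsetP => p; rewrite !inE => /andP[+ pT].
  by rewrite pT.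
apply: leq_trans (loomis_whitney P) _.
rewrite expnS leq_mul //.
  apply: leq_trans (leq_partial_columns S).
  apply/fsubset_leq_card/fsubsetP => _ /imfsetP[p /= + ->].
  by rewrite !inE => pP; apply/imfsetP; exists p.
rewrite expnS expn1 leq_mul //.
  apply: leq_trans (leq_proj_x S).
  by apply/fsubset_leq_card/subset_imfset => p /=; rewrite !inE => /andP[].
apply: leq_trans (leq_proj_y S).
by apply/fsubset_leq_card/subset_imfset => p /=; rewrite !inE => /andP[].
Qed.

End WedgeIsoperimetry.

(** * Growth of [psi] and the comparison of volume with boundary *)

Lemma scale_quotient_cvg (R : realType) (h : R -> R) (rho : R -> nat)
    (h_pos : forall x : R, 0 <= x -> 0 < h x)
    (h_incr : forall x y : R, 0 <= x -> x <= y -> h x <= h y)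
    (rho_gt0 : forall t, 0 <= t -> (0 < rho t)%N)
    (rho_le : forall t m, (m < rho t)%N -> m%:R ^+ 2 * h m%:R <= t) :
  (t + 1) / (rho t)%:R @[t --> +oo] --> +oo.
Proof.
have h0 : 0 < h 0 by exact: h_pos.
apply/cvgryPge => A; pose a := `|A|.
near=> t.
have ta : a <= t by near: t; apply: nbhs_pinfty_ge; rewrite num_real.
(* The previous threshold settles [rho t = 1]; this one settles [rho t >= 2], where
   [(rho t - 1)^2 * h 0 <= t]. *)
have ta2 : 4 * a ^+ 2 / h 0 <= t.
  by near: t; apply: nbhs_pinfty_ge; rewrite num_real.
have a0 : 0 <= a by exact: normr_ge0.
have t0 : 0 <= t by exact: le_trans ta.
rewrite ler_pdivlMr ?ltr0n ?rho_gt0 //.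
apply: le_trans (ler_wpM2r (ler0n _ _) (ler_norm A)) _; rewrite -/a.
case: (rho t) (rho_gt0 t t0) (rho_le t) => // [[|s]] _ rs.
  by rewrite mulr1 (le_trans ta) // lerDl.
have {rs} : s.+1%:R ^+ 2 * h 0 <= t.
  by apply: le_trans (rs s.+1 _) => //; rewrite ler_wpM2l ?sqr_ge0 ?h_incr.
rewrite ler_pdivrMr // in ta2.
have s1 : 1 <= s.+1%:R :> R by rewrite ler1n.
rewrite -[s.+2%:R]natr1; move: s.+1%:R s1 => x x1 xt.
(* Arithmetic-geometric mean for [2a] and [x * h 0], whose squares are both at most [h 0 * t]. *)
have : 0 <= (2 * a - x * h 0) ^+ 2 by exact: sqr_ge0.
have ht : h 0 * (x ^+ 2 * h 0) <= h 0 * t by rewrite ler_pM2l.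
move=> sq; have : 2 * a * x * h 0 <= t * h 0 by nra.
rewrite ler_pM2r // => ?; nra.
Unshelve. all: by end_near.
Qed.

(** One of [V] and [N * b] is at least [t / 2]. If [V] is, then [t^2 <= 4 b^3], and multiplying by
    [t <= (h 1 / gamma) r^3] bounds [t^3] by a multiple of [(r b)^3]. Otherwise [N <= r] gives
    [t <= 2 r b], while [N > r] makes [b] at least a multiple of [r * h r], and [t <= r^2 h r]. *)
Lemma scale_volume_bound (R : realType) (h : R -> R) (gamma : R)
    (h_pos : forall x : R, 0 <= x -> 0 < h x)
    (h_incr : forall x y : R, 0 <= x -> x <= y -> h x <= h y)
    (gamma_gt0 : 0 < gamma)
    (h_reg : forall delta x : R, 0 <= delta <= 1 -> 0 <= x ->
         gamma * delta * h x <= h (delta * x))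
    (t b : R) (r N V : nat) : (1 < r)%N -> 0 <= t -> 0 <= b ->
  t <= r%:R ^+ 2 * h r%:R ->
  t <= N%:R * b + V%:R -> V%:R ^+ 2 <= b ^+ 3 ->
  N./2%:R * h N./2%:R <= b ->
  t <= (3 + 4 * h 1 / gamma + 9 / gamma) * (r%:R * b).
Proof.
move=> r1 t0 b0 tr tNV Vb Nb.
have r0 : 0 < r%:R :> R by rewrite ltr0n ltnW.
have g0 : 0 < gamma^-1 by rewrite invr_gt0.
have gg : gamma * gamma^-1 = 1 by rewrite divff // gt_eqF.
have h1 : 0 < h 1 by exact: h_pos.
have rb0 : 0 <= r%:R * b by rewrite mulr_ge0 // ltW.
have hg0 : 0 <= h 1 * gamma^-1 by rewrite mulr_ge0 // ltW.
have [tV|tN] : t <= 2 * V%:R \/ t <= 2 * (N%:R * b).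
- by have [|] := leP t (2 * V%:R); [left | right; lra].
(* Regularity with [delta = 1 / r] compares [h r] with [h 1]: growth is at most linear. *)
- have hr : h r%:R <= h 1 * gamma^-1 * r%:R.
    have /= := h_reg r%:R^-1 r%:R _ (ltW r0).
    rewrite mulVf ?gt_eqF // invr_ge0 ltW //= invf_le1 // ler1n ltnW //.
    move=> /(_ isT) hr; rewrite mulrAC ler_pdivlMr // mulrC.
    by rewrite -ler_pdivrMr // mulrAC.
  have tr3 : t <= h 1 * gamma^-1 * r%:R ^+ 3.
    apply: le_trans tr _; rewrite [r%:R ^+ 3]exprSr mulrA [leRHS]mulrAC.
    by rewrite [leRHS]mulrC ler_wpM2l // sqr_ge0.
  (* The summand 1 ensures [K <= K^3], which avoids a cube root in the constant. *)
  pose K := 1 + 4 * (h 1 * gamma^-1).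
  have K1 : 1 <= K by rewrite /K; lra.
  apply: (@le_trans _ _ (K * (r%:R * b))); last first.
    by rewrite ler_wpM2r // /K; lra.
  rewrite -(@ler_pXn2r _ 3) // ?nnegrE //; last by rewrite mulr_ge0 //; lra.
  apply: (@le_trans _ _ (h 1 * gamma^-1 * r%:R ^+ 3 * (4 * b ^+ 3))).
    rewrite exprS; apply: ler_pM => //; first exact: sqr_ge0.
    apply: (@le_trans _ _ ((2 * V%:R) ^+ 2)).
      by rewrite ler_pXn2r // nnegrE // mulr_ge0.
    by rewrite exprMn; lra.
  have -> : h 1 * gamma^-1 * r%:R ^+ 3 * (4 * b ^+ 3)
    = 4 * (h 1 * gamma^-1) * (r%:R * b) ^+ 3 by rewrite exprMn; lra.
  rewrite [leRHS]exprMn ler_wpM2r ?exprn_ge0 //.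
  apply: (@le_trans _ _ K); first by rewrite /K; lra.
  by rewrite ler_eXnr.
- have [Nr|rN] := leqP N r.
    have : N%:R * b <= r%:R * b by rewrite ler_wpM2r // ler_nat.
    have : 0 <= h 1 * gamma^-1 * (r%:R * b) by rewrite mulr_ge0.
    have : 0 <= gamma^-1 * (r%:R * b) by rewrite mulr_ge0 // ltW.
    by nra.
  (* The factor 3 rather than 2 absorbs the rounding in [N./2]. *)
  have rk : r%:R <= 3 * N./2%:R :> R by rewrite -natrM ler_nat; lia.
  have hr3 : gamma / 3 * h r%:R <= h N./2%:R.
    apply: le_trans (h_reg 3^-1 r%:R _ (ltW r0)) _; first lra.
    by apply: h_incr; lra.
  have : r%:R / 3 * (gamma / 3 * h r%:R) <= b.
    apply: le_trans Nb; apply: ler_pM => //; try lra.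
    by rewrite mulr_ge0 //; [lra | exact/ltW/h_pos/ltW].
  move=> rhb.
  have : r%:R * h r%:R <= 9 * gamma^-1 * b.
    have := ler_wpM2l (ltW g0) rhb.
    have -> : gamma^-1 * (r%:R / 3 * (gamma / 3 * h r%:R)) =
      (gamma * gamma^-1) * (r%:R * h r%:R) / 9 by lra.
    by rewrite gg; lra.
  move=> /(ler_wpM2l (ltW r0)) rrh.
  have : 0 <= h 1 * gamma^-1 * (r%:R * b) by rewrite mulr_ge0.
  by nra.
Qed.

Theorem proposition1p7 (R : realType) (h : R -> R)
    (h_pos : forall x : R, 0 <= x -> 0 < h x)
    (h_incr : forall x y : R, 0 <= x -> x <= y -> h x <= h y)
    (h_sum : (\sum_(1 <= j <oo) ((j%:R * h j%:R)^-1)%:E < +oo)%E)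
    (h_reg : exists2 gamma : R, 0 < gamma &
       forall delta x : R, 0 <= delta <= 1 -> 0 <= x ->
         gamma * delta * h x <= h (delta * x)) :
  exists psi : R -> R,
    [/\ forall x : R, 0 <= x -> 0 < psi x,
        psi x @[x --> +oo] --> +oo,
        (\sum_(1 <= k <oo) (psi k%:R ^- 2)%:E < +oo)%E &
        forall o : wedge h, anchored_IP (@wedge_adj R h) o psi].
Proof.
have [gamma gamma_gt0 h_scale] := h_reg.
have [rho rhoP] := scale_ex h_pos h_incr.
have rho_le t m : (m < rho t)%N -> m%:R ^+ 2 * h m%:R <= t.
  by have [_] := rhoP t; exact.
have rho_gt0 t : 0 <= t -> (0 < rho t)%N.
  move=> t0; rewrite lt0n; apply/eqP => rt0; have [] := rhoP t.
  by rewrite rt0 expr0n mul0r ltNge t0.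
exists (fun t => (t + 1) / (rho t)%:R); split.
- by move=> x x0; rewrite divr_gt0 ?ltr0n ?rho_gt0 // ltr_wpDl.
- exact: (scale_quotient_cvg h_pos h_incr rho_gt0 rho_le).
- have := scale_series_lty h_pos h_sum rho_le.
  by under eq_eseriesr do rewrite -natr1.
move=> o; rewrite /anchored_IP.
pose K : R := 3 + 4 * h 1 / gamma + 9 / gamma.
have K0 : 0 < K.
  have h1 : 0 < h 1 by exact: h_pos.
  by rewrite /K ltr_wpDr ?ltr_wpDr // ?divr_ge0 ?mulr_ge0 // ltW.
(* From [t <= K * rho t * b] and [t + 1 <= 2 t], the ratio [b * rho t / (t + 1)] is at least
   [1 / (2 K)]. *)
apply: (@lt_le_trans _ _ (2 * K)^-1%:E).
  by rewrite lte_fin invr_gt0 mulr_gt0.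
apply: lime_ge; first exact: anchored_profile_is_cvg.
(* Beyond this size [1^2 * h 1 <= t], which rules out [rho t = 1]. *)
exists (Num.bound (h 1)).+1 => // n /= hn.
apply: le_ereal_inf_tmp => _ [S [_ _ nS] <-]; rewrite lee_fin.
have [N [V [SNV VB NB]]] := wedge_isoperimetry h_pos h_incr S.
set b : nat := edge_boundary_size _ S in SNV VB NB *.
set t : R := #|` S|%:R.
have t1 : 1 <= t by rewrite ler1n (leq_trans _ nS) // (leq_trans _ hn).
have t0 : 0 <= t by exact: le_trans t1.
have r1 : (1 < rho t)%N.
  have h1t : h 1 <= t.
    apply/ltW/(lt_le_trans (archi_boundP (ltW (h_pos 1 ler01)))).
    by rewrite ler_nat (leq_trans _ nS) // ltnW.
  rewrite ltn_neqAle rho_gt0 // andbT; apply/eqP => rt1.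
  by have [] := rhoP t; rewrite -rt1 expr1n mul1r ltNge h1t.
have rt0 : 0 < (rho t)%:R :> R by rewrite ltr0n ltnW.
have /= tK : t <= K * ((rho t)%:R * b%:R).
  apply: (scale_volume_bound h_pos h_incr gamma_gt0 h_scale r1 t0 (ler0n _ _)
    _ _ _ NB).
  - by have [/ltW] := rhoP t.
  - by rewrite -natrM -natrD ler_nat; exact: SNV.
  - by rewrite -!natrX ler_nat; exact: VB.
rewrite invf_div mulrA ler_pdivlMr ?ltr_wpDl //.
rewrite mulrC ler_pdivrMr ?mulr_gt0 //; lra.
Qed.
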